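(* For $n\ge 3$ let $M(n)$ denote the largest reducibility value, for solitaire Clobber on the cycle, among all non-monochromatic cyclic initial conformations with $n$ pawns (that is, conformations containing at least one black and at least one white pawn). Then $M(n)=n/3+O(1)$.
   Context: Solitaire Clobber on a cycle: an initial conformation is a cyclic word $c=c_1\cdots c_n$ ($n\ge 3$), $c_i\in\{\bullet,\circ\}$; a pawn of color $c_i$ (black $\bullet$ or white $\circ$) is placed on position $i$, for each $i\in\mathbb Z/n\mathbb Z$, and positions $i$ and $i+1$ (indices modulo $n$) are adjacent. A legal move consists in moving a pawn from its position onto an adjacent position occupied by a pawn of the opposite color; that latter pawn is removed, and the position left becomes empty. The single player may move a pawn of either color at each turn. The reducibility value of $c$ is the smallest number of remaining pawns that can be obtained by a finite sequence of legal moves starting from $c$. *)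

(* Defs.v *)
From mathcomp Require Import all_boot.

Set Implicit Arguments.
Unset Strict Implicit.
Unset Printing Implicit Defensive.

(* Positions 0, ..., n-1 stand for Z/nZ; [ordS i] is i + 1 modulo n. *)
Definition cadj n (i j : 'I_n) : bool := (j == ordS i) || (i == ordS j).

(* Colors: [true] is black, [false] is white. *)
Notation conformation n := {ffun 'I_n -> bool}.

(* [None] marks an empty position. *)
Notation position n := {ffun 'I_n -> option bool}.

Definition start n (c : conformation n) : position n := [ffun i => Some (c i)].

Definition legal n (s : position n) (i j : 'I_n) : bool :=
  cadj i j &&
  (match s i, s j with Some a, Some b => a != b | _, _ => false end).

Definition play n (s : position n) (i j : 'I_n) : position n :=
  [ffun k => if k == i then None else if k == j then s i else s k].

Definition move n : rel (position n) :=
  fun s t => [exists i, exists j, legal s i j && (t == play s i j)].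

Definition pawns n (s : position n) : nat := #|[set i | s i != None]|.

Definition reducibility n (c : conformation n) : nat :=
  pawns [arg min_(t < start c | connect (@move n) (start c) t) pawns t].

Definition nonmono n (c : conformation n) : bool :=
  [exists i, c i] && [exists i, ~~ c i].

(* For n >= 2 the range of the maximum is nonempty. *)
Definition maxred n : nat := \max_(c : conformation n | nonmono c) reducibility c.

(* Main.v *)
Require Import Defs.
From mathcomp Require Import all_boot all_order all_algebra.
From mathcomp Require Import zify lra.
Import Order.TTheory GRing.Theory Num.Theory.
Local Open Scope ring_scope.

(** Upper bound.  A word x y^a x^b y with x <> y reduces to a single pawn: its
    first pawn marches right through y^a, and then its last pawn marches left.
    In a linear word whose last two letters differ, some factor of this shape
    with length at least 3 can be cut off greedily at the front until at most
    two pawns have to remain at the end; a non-monochromatic cycle can be cut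
    open into such a word.

    Lower bound.  If no three cyclically consecutive pawns are white, every
    block of initial pawns absorbed by one surviving pawn contains at most one
    more white than black pawns, so at least #white - #black pawns survive.
    For the conformation (white white black)^k this is n/3.  Instead of tracking
    the blocks, [pval] bounds the excess of a block by the current and initial
    colors near the surviving pawn; the sum of these bounds never decreases. *)

(** * Lower bound: a sum over the pawns that no move decreases *)

Section LowerBound.

Context {n : nat}.
Implicit Types (c : conformation n) (s t : position n).

(* An upper bound for #white - #black over the block absorbed by the pawn at
   [p]; [f] and [g] are the two neighbor maps.  The color of a pawn differs from
   the initial color of its position exactly when its block extends to one side
   only; [- 2] is the value of the unreachable case of a recolored white pawn
   with both neighbors present. *)
Definition pval (f g : 'I_n -> 'I_n) c s (p : 'I_n) : int :=
  match s p with
  | None => 0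
  | Some false =>
      if ~~ c p then 1 else if (s (f p) == None) || (s (g p) == None) then 0 else - 2
  | Some true =>
      if c p then (if (s (f p) == None) && (s (g p) == None) then 1 else - 1)
      else if ((s (f p) == None) && ~~ c (f p)) || ((s (g p) == None) && ~~ c (g p))
           then 1 else 0
  end.

Lemma pval_sym f g c s p : pval f g c s p = pval g f c s p.
Proof.
by rewrite /pval (andbC (s (f p) == None)) (orbC (_ && _)) (orbC (s (f p) == None)).
Qed.

Lemma pval_le1 f g c s p : pval f g c s p <= (s p != None)%:Z.
Proof. by rewrite /pval; case: (s p) => [[]|] //=; do !case: ifP. Qed.

(** Away from [i] and [f i] a pawn can at most see neighbors become empty, which never lowers its
    term. What remains is a finite check of colors around the move. *)
Lemma pval_play f g c s (i : 'I_n) a :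
    cancel f g -> cancel g f -> (forall k, f k != k) -> (forall k, f (f k) != k) ->
    (forall k, [|| c k, c (f k) | c (f (f k))]) ->
    s i = Some a -> s (f i) = Some (~~ a) ->
  \sum_p pval f g c s p <= \sum_p pval f g c (play s i (f i)) p.
Proof.
move=> fK gK fne ffne no3 si sj; set j := f i in sj *.
have ji : j != i by exact: fne.
have tE k : play s i j k = if k == i then None else if k == j then Some a else s k.
  by rewrite ffunE si.
rewrite !(bigD1 i (P := xpredT)) //= !(bigD1 j (P := fun k => k != i)) //= !addrA.
have emp k : s k = None -> play s i j k = None.
  by move=> sk; rewrite tE; case: eqP => // _; case: eqP => // kj; rewrite kj sj in sk.
apply: lerD; last first.
  apply: ler_sum => k /andP[ki kj]; rewrite /pval tE (negPf ki) (negPf kj).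
  have mono l : (s l == None) ==> (play s i j l == None).
    by apply/implyP => /eqP /emp ->.
  move: (mono (f k)) (mono (g k)).
  by case: (s k) => [[]|] //; case: (s _ == None); case: (s _ == None);
     case: (play s i j _ == None); case: (play s i j _ == None) => //=;
     case: (c k); case: (c (f k)); case: (c (g k)).
have fji : f j != i by exact: ffne.
(* The triples starting at [g i] and at [i] cover the four positions from [g i] to [f j] whose
   initial colors matter. *)
have := no3 (g i); have := no3 i; rewrite gK -/j => n1 n2.
rewrite /pval !tE -/j (fK i) !eqxx (negPf ji) (negPf fji) (negPf (fne j)) si sj /=.
move: n1 n2; case: (a); case: (c i); case: (c j); case: (c (f j)); case: (c (g i));
  case: (s (f j) == None); case: (s (g i) == None) => //=.
Qed.

End LowerBound.

Lemma ordS_neq n (k : 'I_n) : (2 <= n)%N -> ordS k != k.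
Proof.
move=> n2; rewrite -val_eqE /=; have := ltn_ord k; rewrite leq_eqVlt => /orP[/eqP kn|kn].
  by rewrite kn modnn; lia.
by rewrite modn_small //; lia.
Qed.

Lemma val_ordSS n (k : 'I_n) : val (ordS (ordS k)) = (k.+2 %% n)%N.
Proof. by rewrite /= -addn1 modnDml addn1. Qed.

Lemma ordSS_neq n (k : 'I_n) : (3 <= n)%N -> ordS (ordS k) != k.
Proof.
move=> n3; rewrite -val_eqE val_ordSS /=.
case: (ltnP k.+2 n) => h; first by rewrite modn_small //; lia.
have kn := ltn_ord k; rewrite -(@subnK n k.+2) // modnDr modn_small; lia.
Qed.

Lemma pval_move n (c : conformation n) (s t : position n) :
    (3 <= n)%N -> (forall k, [|| c k, c (ordS k) | c (ordS (ordS k))]) -> move s t ->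
  \sum_p pval (@ordS n) (@ord_pred n) c s p <= \sum_p pval (@ordS n) (@ord_pred n) c t p.
Proof.
move=> n3 no3 /existsP[i /existsP[j /andP[/andP[adj ne] /eqP ->]]].
case si: (s i) ne => [a|//]; case sj: (s j) => [b|//] ab.
have {}sj : s j = Some (~~ a) by rewrite sj; case: a b ab {si sj} => [] [].
have n2 : (2 <= n)%N by lia.
case/orP: adj => /eqP jE.
  rewrite jE in sj *; apply: pval_play si sj => //; first exact: ordSK.
  - exact: ord_predK.
  - by move=> k; exact: ordS_neq.
  - by move=> k; exact: ordSS_neq.
have {}jE : j = ord_pred i by rewrite jE ordSK.
(* A move in the other direction is the same case with the neighbor maps exchanged. *)
under eq_bigr do rewrite pval_sym.
under [X in _ <= X]eq_bigr do rewrite pval_sym.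
rewrite jE in sj *; apply: pval_play si sj => //; first exact: ord_predK.
- exact: ordSK.
- by move=> k; rewrite eq_sym -{1}(ord_predK k) ordS_neq.
- by move=> k; rewrite eq_sym -{1}(ord_predK k) -{1}(ord_predK (ord_pred k)) ordSS_neq.
move=> k; have := no3 (ord_pred (ord_pred k)).
by rewrite !ord_predK orbC (orbC (c (ord_pred k))) orbA.
Qed.

Lemma reducibility_min n (c : conformation n) t :
  connect (@move n) (start c) t -> (reducibility c <= pawns t)%N.
Proof. by rewrite /reducibility; case: arg_minnP => [|? _]; [exact: connect0|exact]. Qed.

(** On the full board a white pawn counts 1 and a black one -1, so the sum starts at [n] minus twice
    the number of black pawns; at the end each survivor contributes at most 1. *)
Lemma reducibility_ge n (c : conformation n) :
    (3 <= n)%N -> (forall k, [|| c k, c (ordS k) | c (ordS (ordS k))]) ->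
  (n <= reducibility c + 2 * \sum_i c i)%N.
Proof.
move=> n3 no3; rewrite /reducibility; case: arg_minnP => [|t ct _]; first exact: connect0.
pose V s : int := \sum_p pval (@ordS n) (@ord_pred n) c s p.
have mono s : connect (@move n) s t -> V s <= V t.
  case/connectP => p sp ->; elim: p s sp => [|u p IH] s //= /andP[su /IH].
  by apply: le_trans; exact: pval_move.
have Vt : V t <= (pawns t)%:R.
  rewrite /pawns -sum1_card big_mkcond /= natr_sum.
  by apply: ler_sum => p _; rewrite (le_trans (pval_le1 _ _ _ _ _)) // inE; case: (t p).
have Vs : V (start c) = n%:R - 2 * (\sum_i c i)%N%:R.
  rewrite -[n in n%:R]card_ord -sum1_card !natr_sum mulr_sumr -sumrB.
  by apply: eq_bigr => p _; rewrite /pval !ffunE; case: (c p).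
by have := mono _ ct; rewrite -/V Vs; move/le_trans => /(_ _ Vt); rewrite !natz; lia.
Qed.

(** * The periodic conformation white white black *)

Lemma sum_mod3 n : (\sum_(i < n) (i %% 3 == 2) = n %/ 3)%N.
Proof. by elim: n => [|n IH]; rewrite ?big_ord0 // big_ord_recr /= IH; lia. Qed.

Lemma maxred_ge n : (3 <= n)%N -> (n <= maxred n + 2 * (n %/ 3 + 1))%N.
Proof.
(* The last position is forced black: if 3 does not divide [n], three white pawns would otherwise
   meet across the seam. *)
move=> n3; pose c : conformation n := [ffun i : 'I_n => (i %% 3 == 2)%N || (i.+1 == n)].
have no3 k : [|| c k, c (ordS k) | c (ordS (ordS k))].
  rewrite !ffunE val_ordSS /=.
  have kn := ltn_ord k.
  case: (ltnP k.+1 n) => h1; last by apply/orP; left; lia.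
  rewrite (modn_small h1).
  case: (ltnP k.+2 n) => h2; last by apply/orP; right; apply/orP; left; lia.
  by rewrite (modn_small h2); lia.
have nm : nonmono c.
  apply/andP; split; apply/existsP.
    by have lt2 : (2 < n)%N by []; exists (Ordinal lt2); rewrite ffunE.
  have lt0 : (0 < n)%N by lia.
  by exists (Ordinal lt0); rewrite ffunE /=; lia.
have := reducibility_ge _ c n3 no3.
have : (reducibility c <= maxred n)%N by exact: (leq_bigmax_cond (F := @reducibility n)).
have : (\sum_i c i <= n %/ 3 + 1)%N.
  rewrite -sum_mod3; have lt0 : (n.-1 < n)%N by lia.
  rewrite (bigD1 (Ordinal lt0)) //= [X in (_ <= X + _)%N](bigD1 (Ordinal lt0)) //=.
  rewrite addnC -addnA addnCA leq_add //; last by rewrite (leq_trans (leq_b1 _)) // leq_addl.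
  apply: leq_sum => i; rewrite -val_eqE /= ffunE => /eqP i0.
  by have := ltn_ord i; lia.
by lia.
Qed.

(** * Upper bound: play on linear words *)

(** Emptied places stay in the word as [None], so that lengths and indices never change. *)
Inductive lreach : seq (option bool) -> seq (option bool) -> Prop :=
| lreach_refl l : lreach l l
| lreach_right A B a t :
    lreach (A ++ [:: None, Some a & B]) t ->
    lreach (A ++ [:: Some a, Some (~~ a) & B]) t
| lreach_left A B a t :
    lreach (A ++ [:: Some a, None & B]) t ->
    lreach (A ++ [:: Some (~~ a), Some a & B]) t.

Lemma lreach_trans l2 l1 l3 : lreach l1 l2 -> lreach l2 l3 -> lreach l1 l3.
Proof.
elim=> [//|A B a t _ IH|A B a t _ IH] /IH; [exact: lreach_right|exact: lreach_left].
Qed.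

Lemma lreach_ctx A B l l' : lreach l l' -> lreach (A ++ l ++ B) (A ++ l' ++ B).
Proof.
elim=> [l0|A1 B1 a t _|A1 B1 a t _]; first exact: lreach_refl.
  rewrite -!catA !(catA A) => ?; exact: lreach_right.
rewrite -!catA !(catA A) => ?; exact: lreach_left.
Qed.

Lemma lreach_cat l1 l1' l2 l2' :
  lreach l1 l1' -> lreach l2 l2' -> lreach (l1 ++ l2) (l1' ++ l2').
Proof.
move=> r1 r2; apply: lreach_trans (_ : lreach (l1' ++ l2) _).
  exact: lreach_ctx [::] l2 _ _ r1.
by have := lreach_ctx l1' [::] _ _ r2; rewrite !cats0.
Qed.

Lemma lreach_size l l' : lreach l l' -> size l = size l'.
Proof. by elim=> // A B a t _ <-; rewrite !size_cat. Qed.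

Lemma march_right k x :
  lreach (Some x :: nseq k (Some (~~ x))) (rcons (nseq k None) (Some x)).
Proof.
elim: k => [|k IH] /=; first exact: lreach_refl.
by apply: (lreach_right [::]); exact: (lreach_cat [:: None] [:: None] _ _ (lreach_refl _) IH).
Qed.

Lemma march_left k x :
  lreach (rcons (nseq k (Some (~~ x))) (Some x)) (Some x :: nseq k None).
Proof.
elim: k => [|k IH] /=; first exact: lreach_refl.
apply: lreach_trans (lreach_cat [:: Some (~~ x)] _ _ _ (lreach_refl _) IH) _.
by apply: (lreach_left [::]); exact: lreach_refl.
Qed.

Definition reducible (w : seq bool) (m : nat) :=
  exists2 l, lreach (map Some w) l & (count isSome l <= m)%N.

Lemma reducible_cat u v m1 m2 :
  reducible u m1 -> reducible v m2 -> reducible (u ++ v) (m1 + m2).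
Proof.
move=> [l1 r1 c1] [l2 r2 c2]; exists (l1 ++ l2); first by rewrite map_cat; exact: lreach_cat.
by rewrite count_cat leq_add.
Qed.

Lemma count_isSome_nseq k : count isSome (nseq k (@None bool)) = 0%N.
Proof. by rewrite count_nseq. Qed.

Lemma reducible_run x a : reducible (x :: nseq a (~~ x)) 1.
Proof.
exists (rcons (nseq a None) (Some x)).
  by rewrite /= map_nseq; exact: march_right.
by rewrite -cats1 count_cat count_isSome_nseq.
Qed.

Lemma reducible_two_runs x a b :
  reducible ((x :: nseq a (~~ x)) ++ rcons (nseq b x) (~~ x)) 1.
Proof.
exists (nseq a None ++ Some (~~ x) :: nseq b.+1 None); last first.
  by rewrite count_cat /= !count_isSome_nseq.
rewrite map_cat map_rcons /= !map_nseq.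
apply: lreach_trans (lreach_cat _ _ _ _ (march_right a x) (lreach_refl _)) _.
(* The pawn that marched right joins the next run, so the march back crosses [b.+1] pawns. *)
rewrite cat_rcons; apply: lreach_cat; first exact: lreach_refl.
by have := march_left b.+1 (~~ x); rewrite negbK.
Qed.

Lemma leading_run (y : bool) w :
  exists k, w = nseq k y \/ exists r, w = nseq k y ++ ~~ y :: r.
Proof.
elim: w => [|z w [k IH]]; first by exists 0%N; left.
have [->|zy] := eqVneq z y.
  by exists k.+1; case: IH => [->|[r ->]]; [left|right; exists r].
by exists 0%N; right; exists w; congr cons; case: z y zy {IH} => [] [].
Qed.

(** Strong induction on the length: a prefix of at least three letters is cut off at the cost of one
    pawn, and the hypothesis passes to the suffix. The 5 leaves room for a short tail that keeps up
    to two pawns. *)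
Lemma reducible_third w :
    (forall u z, w <> u ++ [:: z; z]) ->
  exists2 m, reducible w m & (3 * m <= size w + 5)%N.
Proof.
elim/ltn_ind: {w}(size w) {-2}w (erefl (size w)) => N IH [|x w] sN end_ne.
  by exists 0%N => //; exists [::] => //; exact: lreach_refl.
have [a] := leading_run (~~ x) w; rewrite negbK => -[wE|[r wE]].
  by exists 1%N; [rewrite wE; exact: reducible_run|rewrite /=; lia].
have [b [rE|[v rE]]] := leading_run x r; last first.
  have wE' : x :: w = ((x :: nseq a (~~ x)) ++ rcons (nseq b.+1 x) (~~ x)) ++ v.
    by rewrite wE rE -catA cat_rcons.
  have sw : (size v + 3 <= size (x :: w))%N.
    by rewrite wE' !size_cat size_rcons /= !size_nseq; lia.
  have [||m vm m_le] := IH (size v) _ v erefl.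
  - by rewrite -sN; lia.
  - move=> u z vE; move: wE'; rewrite vE catA; exact: end_ne.
  exists (1 + m)%N; last by lia.
  by rewrite wE'; apply: reducible_cat vm; exact: reducible_two_runs.
(* No [~~ x] closes this tail, and a positive [b] would make the word end in two equal letters;
   hence a single [x] is left over as second pawn. *)
have b0 : b = 0%N.
  case: b rE => // b rE; case: (end_ne (x :: nseq a (~~ x) ++ nseq b x) x).
  by rewrite wE rE cat_cons -catA -[[:: x; x]]/(nseq 2 x) -nseqD addn2.
exists 2%N; last by rewrite wE rE b0 /= !size_cat /=; lia.
rewrite wE rE b0 -cat_cons; apply: (reducible_cat _ _ 1 1); first exact: reducible_run.
exact: (reducible_run x 0).
Qed.

Lemma nth_cat2 A B (p q : option bool) k :
  nth None (A ++ [:: p, q & B]) k =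
    if k == size A then p else if k == (size A).+1 then q
    else nth None (A ++ [:: None, None & B]) k.
Proof. by elim: A k => [|o A IH] [|[|k]] //=; exact: IH. Qed.

(** * Laying a linear word around the cycle *)

Section Unroll.

Context {n : nat} {idx : 'I_n -> 'I_n}.
Hypothesis idx_inj : injective idx.
Hypothesis idxS : forall i, idx (ordS i) = ordS (idx i).

(** The hypotheses make [idx] a rotation, that is, a choice of the point where the cycle is cut. *)
Definition on_cycle (l : seq (option bool)) : position n := [ffun i => nth None l (idx i)].

(** The new letters [p'] and [q'] are arbitrary so that captures in both directions are covered. *)
Lemma on_cycle_pair A B p q : size (A ++ [:: p, q & B]) = n ->
  exists i, [/\ ordS i != i, on_cycle (A ++ [:: p, q & B]) i = p,
    on_cycle (A ++ [:: p, q & B]) (ordS i) = q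
    & forall p' q', on_cycle (A ++ [:: p', q' & B]) =
        [ffun k => if k == i then p' else if k == ordS i then q'
                   else on_cycle (A ++ [:: p, q & B]) k]].
Proof.
rewrite size_cat /= => sz; have An : (size A < n)%N by lia.
have [inv _ invK] := injF_bij idx_inj.
pose i := inv (Ordinal An); have Si : ordS i != i by apply: ordS_neq; lia.
have nthE p' q' k : on_cycle (A ++ [:: p', q' & B]) k =
    if k == i then p' else if k == ordS i then q'
    else nth None (A ++ [:: None, None & B]) (idx k).
  rewrite ffunE nth_cat2 -(inj_eq idx_inj k i) -(inj_eq idx_inj k (ordS i)).
  by rewrite idxS invK -!val_eqE /= modn_small //; lia.
exists i; split=> //; rewrite ?nthE ?eqxx ?(negPf Si) ?eqxx //.
move=> p' q'; apply/ffunP => k; rewrite nthE ffunE nthE.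
by do 2![case: eqP => // _].
Qed.

Lemma on_cycle_reach l l' :
  size l = n -> lreach l l' -> connect (@move n) (on_cycle l) (on_cycle l').
Proof.
move=> + r; elim: r => [l0|A B a t _ IH|A B a t _ IH] sz; first exact: connect0.
  apply: connect_trans (IH _); last by rewrite -sz !size_cat.
  have [i [_ + + /(_ None (Some a)) ->]] := on_cycle_pair _ _ _ _ sz.
  move: (on_cycle _) => s si sj; apply: connect1.
  apply/existsP; exists i; apply/existsP; exists (ordS i).
  rewrite /legal /cadj eqxx si sj /=; apply/andP; split; first by case: (a).
  by apply/eqP/ffunP => k; rewrite !ffunE si.
apply: connect_trans (IH _); last by rewrite -sz !size_cat.
have [i [Si + + /(_ (Some a) None) ->]] := on_cycle_pair _ _ _ _ sz.
move: (on_cycle _) => s si sj; apply: connect1.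
apply/existsP; exists (ordS i); apply/existsP; exists i.
rewrite /legal /cadj eqxx orbT si sj /=; apply/andP; split; first by case: (a).
apply/eqP/ffunP => k; rewrite !ffunE sj.
by have [->|] := eqVneq k i; rewrite // eq_sym (negPf Si).
Qed.

Lemma pawns_on_cycle l : size l = n -> pawns (on_cycle l) = count isSome l.
Proof.
move=> sz; rewrite /pawns -sum1_card big_mkcond /=.
rewrite -sum1_count (big_nth None) sz big_mkord [RHS]big_mkcond /=.
rewrite [RHS](reindex idx) /=; last exact/onW_bij/injF_bij.
by apply: eq_bigr => i _; rewrite inE ffunE; case: nth.
Qed.

End Unroll.

(** * Cutting a non-monochromatic cycle open *)

Lemma val_iter_ordS n k (i : 'I_n) : val (iter k (@ordS n) i) = ((i + k) %% n)%N.
Proof.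
elim: k => [|k IH] /=; first by rewrite addn0 modn_small.
by rewrite IH -addn1 modnDml addn1 addnS.
Qed.

Lemma iter_ordS_to n (i j : 'I_n) : exists k, iter k (@ordS n) i = j.
Proof.
exists (j + (n - i))%N; apply: val_inj; rewrite val_iter_ordS.
have -> : (i + (j + (n - i)) = j + n)%N by have := ltn_ord i; lia.
by rewrite modnDr modn_small.
Qed.

(** Otherwise the color would be constant along the orbit of [ordS], which is the whole cycle. *)
Lemma color_change n (c : conformation n) :
  nonmono c -> exists e, c e != c (ordS e).
Proof.
case/andP=> /existsP[i ci] /existsP[j cj]; apply/existsP; apply: contraT => /existsPn same.
have iterE k : c (iter k (@ordS n) i) = c i.
  by elim: k => //= k <-; apply/esym/eqP; rewrite -[_ == _]negbK.
by have [k kj] := iter_ordS_to _ i j; move: cj; rewrite -kj iterE ci.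
Qed.

Lemma reducibility_le n (c : conformation n) :
  (3 <= n)%N -> nonmono c -> (3 * reducibility c <= n + 5)%N.
Proof.
move=> n3 /color_change[e ce].
(* The rotation takes [e] and [ordS e] to the last two places, so that the word ends in two
   different letters. *)
have lt2 : (n.-2 < n)%N by lia.
have [d dE] := iter_ordS_to _ e (Ordinal lt2).
pose idx : 'I_n -> 'I_n := iter d (@ordS n).
have idx_inj : injective idx.
  by rewrite /idx; elim: d {dE idx} => [|d IH] //= i j /(can_inj (@ordSK n)) /IH.
have idxS i : idx (ordS i) = ordS (idx i) by rewrite /idx -iterSr.
have [inv idxK invK] := injF_bij idx_inj.
pose w := [seq c (inv k) | k <- enum 'I_n].
have sw : size w = n by rewrite size_map size_enum_ord.
have wE (k : 'I_n) : nth true w k = c (inv k).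
  by rewrite (nth_map k) ?size_enum_ord // nth_ord_enum.
have [|m [l wl lm] m_le] := reducible_third w.
  move=> u z wu; case/eqP: ce; have su : size u = n.-2.
    by move: sw; rewrite wu size_cat /=; lia.
  have := wE (idx (ordS e)); have := wE (idx e); rewrite !idxK idxS => <- <-.
  rewrite /idx dE /= wu !nth_cat su ltnn subnn /= modn_small; last by lia.
  have -> : n.-2.+1 = n.-1 by lia.
  have -> : (n.-1 < n.-2)%N = false by lia.
  by have -> : (n.-1 - n.-2 = 1)%N by lia.
have startE : start c = on_cycle (idx := idx) (map Some w).
  by apply/ffunP => i; rewrite !ffunE (nth_map true) ?sw // wE idxK.
have szm : size (map Some w) = n by rewrite size_map.
rewrite sw in m_le; apply: leq_trans m_le; rewrite leq_mul2l /=.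
apply: leq_trans lm; rewrite -(pawns_on_cycle idx_inj) -?(lreach_size _ _ wl) //.
by apply: reducibility_min; rewrite startE; exact: on_cycle_reach.
Qed.

Lemma maxred_le n : (3 <= n)%N -> (3 * maxred n <= n + 5)%N.
Proof.
move=> n3; suff : (maxred n <= (n + 5) %/ 3)%N by lia.
by apply/bigmax_leqP => c nm; have := reducibility_le _ c n3 nm; lia.
Qed.

Theorem mainTheorem4 :
  exists C : rat, forall n : nat, (3 <= n)%N ->
    `| (maxred n)%:R - n%:R / 3%:R | <= C.
Proof.
(* With M for [maxred n], the bounds 3M <= n + 5 and n <= 3M + 6 put M - n/3 between -2 and 5/3. *)
exists 2%:R => n n3.
have hi : 3%:R * (maxred n)%:R <= n%:R + 5%:R :> rat.
  by rewrite -natrM -natrD ler_nat maxred_le.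
have lo : n%:R <= 3%:R * (maxred n)%:R + 6%:R :> rat.
  by rewrite -natrM -natrD ler_nat; have := maxred_ge n n3; lia.
by rewrite ler_norml; apply/andP; split; lra.
Qed.
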